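(* The monoid $M(aabb)$ is of type $2^{\aleph_0}$; that is, the monoid variety generated by $M(aabb)$ has uncountably many subvarieties.
   Context: Let $\mathscr X$ be a countably infinite alphabet and $\mathscr X^\ast$ the free monoid over $\mathscr X$ (elements are words, including the empty word $1$). For a set $\mathscr W$ of words, $M(\mathscr W)$ denotes the Rees quotient of $\mathscr X^\ast$ modulo the ideal consisting of all words that are not subwords (factors) of any word in $\mathscr W$; so $M(\mathscr W)$ consists of all subwords of words in $\mathscr W$ (including the empty word $1$) together with a zero element $0$, with multiplication being concatenation when the result is again such a subword and $0$ otherwise. For a single word $\mathbf w$, $M(\mathbf w)=M(\{\mathbf w\})$; here $a,b$ are distinct letters, so $M(aabb)$ has order ten. Varieties are varieties of monoids (classes closed under homomorphic images, submonoids, and arbitrary direct products). A monoid is of type $2^{\aleph_0}$ if the variety it generates has uncountably many subvarieties. *)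

(* Defs.v *)
From mathcomp Require Import all_boot.
From Stdlib Require Import FunctionalExtensionality.

Set Implicit Arguments.
Unset Strict Implicit.
Unset Printing Implicit Defensive.

Record Mon := MkMon {
  mcarrier :> Type;
  mmul : mcarrier -> mcarrier -> mcarrier;
  mone : mcarrier;
  mmulA : forall x y z, mmul x (mmul y z) = mmul (mmul x y) z;
  mmul1l : forall x, mmul mone x = x;
  mmul1r : forall x, mmul x mone = x }.

Definition is_hom (A B : Mon) (f : A -> B) : Prop :=
  (forall x y, f (mmul x y) = mmul (f x) (f y)) /\ f (mone A) = mone B.

Section Prod.
Variables (I : Type) (A : I -> Mon).
Definition pmul (x y : forall i, A i) : forall i, A i := fun i => mmul (x i) (y i).
Definition pone : forall i, A i := fun i => mone (A i).
Lemma pmulA x y z : pmul x (pmul y z) = pmul (pmul x y) z.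
Proof. apply: functional_extensionality_dep => i; exact: mmulA. Qed.
Lemma pmul1l x : pmul pone x = x.
Proof. apply: functional_extensionality_dep => i; exact: mmul1l. Qed.
Lemma pmul1r x : pmul x pone = x.
Proof. apply: functional_extensionality_dep => i; exact: mmul1r. Qed.
Definition prodMon : Mon := MkMon pmulA pmul1l pmul1r.
End Prod.

Definition MonClass := Mon -> Prop.

Definition closedH (K : MonClass) : Prop :=
  forall (A B : Mon) (f : A -> B), K A -> is_hom f ->
    (forall b : B, exists a : A, f a = b) -> K B.
(* closed under submonoids (up to isomorphism: B embeds into A) *)
Definition closedS (K : MonClass) : Prop :=
  forall (A B : Mon) (f : B -> A), K A -> is_hom f -> injective f -> K B.
Definition closedP (K : MonClass) : Prop :=
  forall (I : Type) (A : I -> Mon), (forall i, K (A i)) -> K (prodMon A).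

Definition is_variety (K : MonClass) : Prop := closedH K /\ closedS K /\ closedP K.

Definition varGen (M : Mon) : MonClass :=
  fun B => forall K, is_variety K -> K M -> K B.

Definition subvariety (K V : MonClass) : Prop :=
  is_variety K /\ (forall A, K A -> V A).

Definition same_class (K L : MonClass) : Prop := forall A, K A <-> L A.

Definition uncountably_many_subvarieties (M : Mon) : Prop :=
  forall W : nat -> MonClass,
    exists K, subvariety K (varGen M) /\ forall n, ~ same_class K (W n).

(* The Rees quotient monoid M(W): words over the alphabet nat          *)
(* (countably infinite); Some u = the factor u, None = zero.           *)
Section ReesMon.
Variable Ws : seq (seq nat).

Definition isFactor (u : seq nat) : bool := has (infix u) Ws.

Definition RElt := option {u : seq nat | isFactor u}.

Lemma isFactor_catl u v : isFactor (u ++ v) -> isFactor u.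
Proof. by apply: sub_has => s; apply: catr_infix. Qed.
Lemma isFactor_catr u v : isFactor (u ++ v) -> isFactor v.
Proof. by apply: sub_has => s; apply: catl_infix. Qed.
Definition rmul (x y : RElt) : RElt :=
  match x, y with
  | Some u, Some v => insub (sval u ++ sval v)
  | _, _ => None
  end.

Definition rone : RElt := insub [::].

Lemma rmulA x y z : rmul x (rmul y z) = rmul (rmul x y) z.
Proof.
case: x => [[u hu]|]; case: y => [[v hv]|]; case: z => [[t ht]|] //=;
  rewrite /rmul /=; try by case: insubP.
case: (insubP _ (v ++ t)) => [[vt hvt] Hvt /= -> | Hvt] /=;
case: (insubP _ (u ++ v)) => [[uv huv] Huv /= -> | Huv] /=.
- by rewrite catA.
- by case: insubP => // -[w hw] /= + _; rewrite catA => /isFactor_catl; rewrite (negbTE Huv).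
- by case: insubP => // -[w hw] /= + _; rewrite -catA => /isFactor_catr; rewrite (negbTE Hvt).
- by [].
Qed.

Lemma rmul1l x : rmul rone x = x.
Proof.
rewrite /rone; case: x => [[u hu]|]; case: insubP => [[e he] He /= Ee|He] //=.
  by rewrite Ee /= insubT.
by case/negP: He; move: hu; rewrite /isFactor; apply: sub_has => s _; exact: infix0s.
Qed.

Lemma rmul1r x : rmul x rone = x.
Proof.
rewrite /rone; case: x => [[u hu]|]; case: insubP => [[e he] He /= Ee|He] //=.
  by rewrite Ee /= cats0 insubT.
by case/negP: He; move: hu; rewrite /isFactor; apply: sub_has => s _; exact: infix0s.
Qed.

Definition ReesMon : Mon := MkMon rmulA rmul1l rmul1r.
End ReesMon.

Definition MW (Ws : seq (seq nat)) : Mon := ReesMon Ws.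
Definition Mw (w : seq nat) : Mon := MW [:: w].

(* the letters a := 0, b := 1 of the alphabet nat *)
Definition aabb : seq nat := [:: 0; 0; 1; 1].

(* Main.v *)
Require Import Defs.
From mathcomp Require Import all_boot zify.
From Stdlib Require Import FunctionalExtensionality ClassicalEpsilon ProofIrrelevance.

Set Implicit Arguments.
Unset Strict Implicit.
Unset Printing Implicit Defensive.

(* A word in which every letter occurs exactly twice turns each letter into an
   interval, from its first to its last occurrence, and the identities of M(aabb)
   preserve the resulting interval order, because M(aabb) detects that the
   restriction of a word to two letters is xxyy. Hence the syntactic monoid A of the
   set of all words realizing a given interval order P lies in var M(aabb).
   If P is prime (its only homogeneous sets are trivial) and p f(u) q realizes P,
   where u is a word with all letters occurring twice and f is a substitution, then
   the letters of f(u) form a homogeneous set, so f(u) is empty, the square of a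
   letter, or all of p f(u) q; in the last case P embeds into the interval order of u.
   An infinite antichain (P_n) of prime interval orders, with representing words u_n,
   therefore gives monoids A_n in var M(aabb) such that A_m satisfies
   u_n = (x_1 ... x_k)(x_1 ... x_k) if and only if m <> n, and distinct sets of
   these identities define distinct subvarieties. *)

(** * Identities and the varieties they define *)

Section Identities.
Variable B : Mon.

Definition ev (f : nat -> B) (w : seq nat) : B :=
  foldr (fun x b => mmul (f x) b) (mone B) w.

Definition satisfies (u v : seq nat) : Prop := forall f, ev f u = ev f v.

Lemma ev_cat f u v : ev f (u ++ v) = mmul (ev f u) (ev f v).
Proof. by elim: u => [|x u IH] /=; rewrite ?mmul1l // IH mmulA. Qed.

End Identities.

Lemma ev_hom (A B : Mon) (h : A -> B) (f : nat -> A) w :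
  is_hom h -> h (ev f w) = ev (fun x => h (f x)) w.
Proof. by case=> hM h1; elim: w => [|x w IH] //=; rewrite hM IH. Qed.

Lemma ev_prod (I : Type) (A : I -> Mon) (f : nat -> prodMon A) w :
  ev f w = fun i => ev (fun x => f x i) w.
Proof. by elim: w => [|x w IH] //=; rewrite IH. Qed.

Lemma varGen_variety M : is_variety (varGen M).
Proof.
split; [|split].
- move=> A B f VA hf sf K vK KM; case: (vK) => cH _; exact: (cH A B f (VA K vK KM)).
- move=> A B f VA hf jf K vK KM; case: (vK) => _ [cS _]; exact: (cS A B f (VA K vK KM)).
- move=> I A VA K vK KM; case: (vK) => _ [_ cP]; apply: cP => i; exact: VA.
Qed.

Lemma satisfies_variety u v : is_variety (fun B => satisfies B u v).
Proof.
split; [|split].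
- move=> A B h sA hh sh f.
  (* Choice lifts the valuation [f] along the surjection [h]. *)
  have [g gP] : exists g : nat -> A, forall x, h (g x) = f x.
    exists (fun x => sval (constructive_indefinite_description _ (sh (f x)))) => x.
    by case: constructive_indefinite_description.
  have -> : f = fun x => h (g x) by apply: functional_extensionality => x; rewrite gP.
  by rewrite -!ev_hom // sA.
- by move=> A B h sA hh jh f; apply: jh; rewrite !ev_hom // sA.
- move=> I A sA f; rewrite !ev_prod.
  apply: functional_extensionality_dep => i; exact: sA.
Qed.

Lemma meet_variety (J : Type) (D : J -> Prop) (V : MonClass) (F : J -> MonClass) :
  is_variety V -> (forall j, is_variety (F j)) ->
  is_variety (fun B => V B /\ forall j, D j -> F j B).
Proof.
move=> [VH [VS VP]] vF; split; [|split].
- move=> A B f [VA FA] hf sf; split; first exact: (VH A B f).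
  by move=> j Dj; case: (vF j) => cH _; apply: (cH A B f (FA j Dj)).
- move=> A B f [VA FA] hf jf; split; first exact: (VS A B f).
  by move=> j Dj; case: (vF j) => _ [cS _]; apply: (cS A B f (FA j Dj)).
- move=> I A FA; split; first by apply: VP => i; case: (FA i).
  by move=> j Dj; case: (vF j) => _ [_ cP]; apply: cP => i; case: (FA i) => _; apply.
Qed.

(* The subvariety escaping [W] imposes the identity [n] exactly when [A n] is in [W n]. *)
Lemma uncountable_of_independent (M : Mon) (A : nat -> Mon) (u v : nat -> seq nat) :
  (forall n, varGen M (A n)) ->
  (forall m n, m <> n -> satisfies (A m) (u n) (v n)) ->
  (forall n, ~ satisfies (A n) (u n) (v n)) ->
  uncountably_many_subvarieties M.
Proof.
move=> VA sA nA W.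
pose K (B : Mon) :=
  varGen M B /\ forall n, ~ ~ W n (A n) -> satisfies B (u n) (v n).
exists K; split.
  split; last by move=> B [].
  apply: (@meet_variety nat (fun n => ~ ~ W n (A n)) (varGen M)
            (fun n B => satisfies B (u n) (v n))).
    exact: varGen_variety.
  by move=> n; apply: satisfies_variety.
move=> n eKW.
have nWA : ~ W n (A n).
  move=> WA; case: (eKW (A n)) => _ /(_ WA)[_ /(_ n) sn].
  by apply: (nA n); apply: sn.
apply: (nWA); apply/eKW; split=> // k nnW; apply: sA => enk.
by rewrite -enk in nnW; apply: nnW.
Qed.

(** * Submonoids and substitutions *)

Lemma sig_eq (T : Type) (P : T -> Prop) (x y : {t | P t}) : sval x = sval y -> x = y.
Proof. by case: x y => [x px] [y py] /= e; apply: subset_eq_compat. Qed.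

Section Submonoid.
Variables (A : Mon) (P : A -> Prop).
Hypothesis P1 : P (mone A).
Hypothesis PM : forall x y, P x -> P y -> P (mmul x y).

Definition submul (x y : {a | P a}) : {a | P a} :=
  exist P (mmul (sval x) (sval y)) (PM (proj2_sig x) (proj2_sig y)).
Definition subone : {a | P a} := exist P _ P1.

Lemma submulA x y z : submul x (submul y z) = submul (submul x y) z.
Proof. by apply: sig_eq; apply: mmulA. Qed.
Lemma submul1l x : submul subone x = x.
Proof. by apply: sig_eq; apply: mmul1l. Qed.
Lemma submul1r x : submul x subone = x.
Proof. by apply: sig_eq; apply: mmul1r. Qed.

Definition subMon : Mon := MkMon submulA submul1l submul1r.
End Submonoid.

Definition subst (f : nat -> seq nat) (w : seq nat) : seq nat := flatten (map f w).

Lemma subst_cons f x w : subst f (x :: w) = f x ++ subst f w.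
Proof. by []. Qed.

Lemma subst_cat f u v : subst f (u ++ v) = subst f u ++ subst f v.
Proof. by rewrite /subst map_cat flatten_cat. Qed.

(** * Syntactic monoids *)

Section Syntactic.
Variable L : pred (seq nat).

Definition ctx (w p q : seq nat) : bool := L (p ++ w ++ q).

Lemma ctx_cat u u' v v' :
  ctx u = ctx u' -> ctx v = ctx v' -> ctx (u ++ v) = ctx (u' ++ v').
Proof.
move=> eu ev; apply: functional_extensionality => p; apply: functional_extensionality => q.
transitivity (ctx u p (v ++ q)); first by rewrite /ctx -!catA.
rewrite eu; transitivity (ctx v (p ++ u') q); first by rewrite /ctx -!catA.
by rewrite ev /ctx -!catA.
Qed.

(** A class is encoded as the set of contexts of one of its words, so that equality of classes is
    equality of functions. *)
Definition syn : Type := {c : seq nat -> seq nat -> bool | exists w, c = ctx w}.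

Definition cls (w : seq nat) : syn := exist _ (ctx w) (ex_intro _ w erefl).

Definition rep (c : syn) : seq nat :=
  sval (constructive_indefinite_description _ (proj2_sig c)).

Lemma ctx_rep c : ctx (rep c) = sval c.
Proof. by rewrite /rep; case: constructive_indefinite_description. Qed.

Lemma cls_eq u v : ctx u = ctx v -> cls u = cls v.
Proof. by move=> e; apply: sig_eq. Qed.

Lemma cls_rep c : cls (rep c) = c.
Proof. by apply: sig_eq; apply: ctx_rep. Qed.

Definition synmul (c d : syn) : syn := cls (rep c ++ rep d).

Lemma cls_cat u v : synmul (cls u) (cls v) = cls (u ++ v).
Proof. by apply: cls_eq; apply: ctx_cat; rewrite ctx_rep. Qed.

Lemma synmulA x y z : synmul x (synmul y z) = synmul (synmul x y) z.
Proof. by rewrite -(cls_rep x) -(cls_rep y) -(cls_rep z) !cls_cat catA. Qed.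
Lemma synmul1l x : synmul (cls [::]) x = x.
Proof. by rewrite -(cls_rep x) cls_cat. Qed.
Lemma synmul1r x : synmul x (cls [::]) = x.
Proof. by rewrite -(cls_rep x) cls_cat cats0. Qed.

Definition synMon : Mon := MkMon synmulA synmul1l synmul1r.

Lemma ev_syn (f : nat -> synMon) w : ev f w = cls (subst (fun x => rep (f x)) w).
Proof.
elim: w => [|x w IH] //=; rewrite IH /= -{1}(cls_rep (f x)).
exact: cls_cat.
Qed.

Lemma ev_cls w : ev (fun x => cls [:: x] : synMon) w = cls w.
Proof. by elim: w => [|x w IH] //=; rewrite IH; apply: cls_cat. Qed.

Lemma synMon_satisfies u v :
  (forall f p q, L (p ++ subst f u ++ q) = L (p ++ subst f v ++ q)) ->
  satisfies synMon u v.
Proof.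
move=> eL f; rewrite !ev_syn; apply: cls_eq.
by apply: functional_extensionality => p; apply: functional_extensionality => q; apply: eL.
Qed.

Lemma synMon_satisfiesW u v : satisfies synMon u v -> L u = L v.
Proof.
move/(_ (fun x => cls [:: x])); rewrite !ev_cls => /(congr1 (fun c => sval c [::] [::])) /=.
by rewrite /ctx /= !cats0.
Qed.

(** The word functions on [M] form a relatively free monoid inside a power of [M]. Identities of [M]
    preserve [L], hence contexts, so [synMon] is a quotient of this monoid. *)
Lemma synMon_varGen (M : Mon) :
  (forall u v, satisfies M u v -> L u = L v) -> varGen M synMon.
Proof.
move=> closedL K [cH [cS cP]] KM.
pose P := prodMon (fun _ : nat -> M => M).
pose E w : P := fun f => ev f w.
have EM u v : E (u ++ v) = mmul (E u) (E v).
  by apply: functional_extensionality => f; apply: ev_cat.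
have ctxE u v : E u = E v -> ctx u = ctx v.
  move=> e; apply: functional_extensionality => p; apply: functional_extensionality => q.
  by apply: closedL => f; rewrite !ev_cat -![ev f u]/(E u f) e.
pose Q (x : P) := exists w, x = E w.
have Q1 : Q (mone P) by exists [::].
have QM x y : Q x -> Q y -> Q (mmul x y).
  by move=> [u ->] [v ->]; exists (u ++ v); rewrite EM.
have KF : K (subMon Q1 QM).
  apply: (cS P (subMon Q1 QM) sval) => //; first by apply: cP.
  by move=> x y; apply: sig_eq.
pose word (x : subMon Q1 QM) := sval (constructive_indefinite_description _ (proj2_sig x)).
have wordE x : E (word x) = sval x.
  by rewrite /word; case: constructive_indefinite_description.
apply: (cH _ synMon (fun x => cls (word x)) KF).
  split=> [x y|].
    by rewrite [RHS]cls_cat; apply/cls_eq/ctxE; rewrite EM !wordE.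
  by apply/cls_eq/ctxE; rewrite wordE.
move=> c; exists (exist Q (E (rep c)) (ex_intro _ (rep c) erefl)).
by rewrite -[RHS]cls_rep; apply/cls_eq/ctxE; rewrite wordE.
Qed.

End Syntactic.

(** * Words realizing interval systems *)

Lemma subseq2_cons (c a x : nat) s :
  subseq [:: c; a] (x :: s) = if c == x then a \in s else subseq [:: c; a] s.
Proof. by rewrite [LHS]/=; case: eqP => _ //; rewrite sub1seq. Qed.

Lemma subseq2_cat (c a : nat) s t :
  subseq [:: c; a] (s ++ t) =
  [|| subseq [:: c; a] s, (c \in s) && (a \in t) | subseq [:: c; a] t].
Proof.
elim: s => [|x s IH] //.
rewrite cat_cons !subseq2_cons inE; case: eqP => [_|_] //.
rewrite mem_cat; case: (a \in s) => //=; case at' : (a \in t) => //=.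
by apply/esym/negP => /mem_subseq/(_ a); rewrite !inE eqxx orbT at' => /(_ isT).
Qed.

Lemma subseq2_notin (c a : nat) s :
  (c \notin s) || (a \notin s) -> subseq [:: c; a] s = false.
Proof.
by move=> no; apply/negP => /mem_subseq ms; move: no; rewrite !ms // !inE eqxx ?orbT.
Qed.

Lemma subseq_count2 (y : nat) w : count_mem y w = 2 -> subseq [:: y; y] w.
Proof.
move=> c; have := filter_subseq (pred1 y) w.
by rewrite (all_pred1P y _ (filter_all _ w)) size_filter c.
Qed.

Lemma mem_substP f w (a : nat) :
  reflect (exists2 x, x \in w & a \in f x) (a \in subst f w).
Proof. exact: flatten_mapP. Qed.

Lemma subst_subseq2 f w (x y a c : nat) :
  subseq [:: y; x] w -> c \in f y -> a \in f x -> subseq [:: c; a] (subst f w).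
Proof.
move=> + cy ax; elim: w => [|z w IH] //.
rewrite subst_cons subseq2_cat subseq2_cons; case: eqP => [<-|_ /IH->]; last by rewrite !orbT.
rewrite cy => xw.
have -> : a \in subst f w by apply/mem_substP; exists x.
by rewrite orbT.
Qed.

(** In [subst f w] the letter [c] occurs only in images of [y] and [a] only in images of [x]; these
    are different blocks, ordered as in [w]. *)
Lemma subst_subseq2E f w (x y a c : nat) :
  x != y -> c \in f y -> a \in f x ->
  {in w, forall z, c \in f z -> z = y} -> {in w, forall z, a \in f z -> z = x} ->
  subseq [:: c; a] (subst f w) = subseq [:: y; x] w.
Proof.
move=> nxy cy ax uc ua; apply/idP/idP; last by move=> /subst_subseq2; apply.
elim: w uc ua => [|z w IH] // uc ua.
rewrite subst_cons subseq2_cat => /or3P[s2|/andP[cz aw]|/IH s2].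
- have := mem_subseq s2; move=> ms.
  have ez : z = y by apply: uc (ms c _); rewrite !inE eqxx.
  have ez' : z = x by apply: ua (ms a _); rewrite !inE eqxx ?orbT.
  by move: nxy; rewrite -ez -ez' eqxx.
- have -> : z = y by apply: uc cz; rewrite inE eqxx.
  rewrite subseq2_cons eqxx.
  case/mem_substP: aw => z' z'w az'; rewrite -(ua z') // inE z'w orbT //.
- apply: subseq_trans (subseq_cons w z); apply: s2 => z' z'w; [apply: uc|apply: ua];
  by rewrite inE z'w orbT.
Qed.

Lemma subst_perm f u v : perm_eq u v -> perm_eq (subst f u) (subst f v).
Proof. by move=> uv; apply/perm_flatten/perm_map. Qed.

(* [l i <= r j] expresses that the interval [[l i, r i]] does not lie strictly
   to the right of [[l j, r j]]. *)
Definition realizes (k : nat) (l r : nat -> nat) (w : seq nat) : bool :=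
  [&& all (fun i => i < k) w,
      all (fun i => count_mem i w == 2) (iota 0 k) &
      all (fun i => all (fun j => (i == j) || (subseq [:: i; j] w == (l i <= r j)))
                        (iota 0 k)) (iota 0 k)].

Lemma realizesP k l r w :
  reflect [/\ forall i, i \in w -> i < k,
              forall i, i < k -> count_mem i w = 2 &
              forall i j, i < k -> j < k -> i != j ->
                subseq [:: i; j] w = (l i <= r j)]
          (realizes k l r w).
Proof.
apply: (iffP and3P) => [[/allP h1 /allP h2 /allP h3]|[h1 h2 h3]]; split.
- exact: h1.
- by move=> i ik; apply/eqP/h2; rewrite mem_iota.
- move=> i j ik jk nij; have := h3 i; rewrite mem_iota ik => /(_ isT)/allP/(_ j).
  by rewrite mem_iota jk (negbTE nij) => /(_ isT)/eqP.
- exact/allP.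
- by apply/allP => i; rewrite mem_iota => /andP[_ ik]; rewrite h2.
- apply/allP => i; rewrite mem_iota => /andP[_ ik].
  apply/allP => j; rewrite mem_iota => /andP[_ jk].
  by case: eqVneq => //= nij; rewrite h3.
Qed.

(** * Identities of [M(aabb)] *)

Lemma ev_insub Ws (f : nat -> seq nat) w :
  ev (fun x => insub (f x) : ReesMon Ws) w = insub (subst f w).
Proof.
elim: w => [|x w IH] //=; rewrite IH /= /rmul.
case: insubP => [[s hs] _ /= es|nx].
  case: insubP => [[t ht] _ /= et|nw]; first by rewrite es et.
  by rewrite insubF //; apply/negbTE; apply: contra nw; apply: isFactor_catr.
by rewrite insubF //; apply/negbTE; apply: contra nx; apply: isFactor_catl.
Qed.

(** Factors of [x] are nonzero and pairwise distinct in the Rees quotient, so an identity with such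
    a value is an equality of words. *)
Lemma Mw_isoterm x u v f :
  satisfies (Mw x) u v -> infix (subst f u) x -> subst f v = subst f u.
Proof.
move=> /(_ (fun y => insub (f y))); rewrite !ev_insub => e ux.
have hu : isFactor [:: x] (subst f u) by rewrite /isFactor /= ux.
rewrite insubT in e; case: insubP e => // -[s hs] _ /= <- [//].
Qed.

(** Restriction to the letters [i] and [j], renamed to those of [aabb]; [mark i i] counts
    occurrences of [i]. *)
Definition mark (i j x : nat) : seq nat :=
  if x == i then [:: 0] else if x == j then [:: 1] else [::].

Lemma subst_mark1 i w : subst (mark i i) w = nseq (count_mem i w) 0.
Proof.
elim: w => [|x w IH] //; rewrite subst_cons IH /mark /=.
by case: (x == i).
Qed.

Lemma count_mark0 i j w : count_mem 0 (subst (mark i j) w) = count_mem i w.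
Proof.
elim: w => [|x w IH] //; rewrite subst_cons count_cat IH /mark /=.
by case: (x == i) => //; case: (x == j).
Qed.

Lemma count_mark1 i j w : i != j -> count_mem 1 (subst (mark i j) w) = count_mem j w.
Proof.
move=> nij; elim: w => [|x w IH] //; rewrite subst_cons count_cat IH /mark /=.
by case: eqP => [->|_]; [rewrite (negbTE nij)|case: (x == j)].
Qed.

Lemma mark_lt2 i j w : all (fun x => x < 2) (subst (mark i j) w).
Proof.
apply/allP => a /mem_substP[x _]; rewrite /mark.
by case: (x == i); [|case: (x == j)]; rewrite ?inE // => /eqP->.
Qed.

Lemma mark_aabb i j w :
  i != j -> count_mem i w = 2 -> count_mem j w = 2 ->
  (subst (mark i j) w == aabb) = ~~ subseq [:: j; i] w.
Proof.
move=> nij ci cj.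
have mi x : (0 \in mark i j x) = (x == i).
  by rewrite /mark; case: (x == i) => //; case: (x == j).
have mj x : (1 \in mark i j x) = (x == j).
  by rewrite /mark; case: eqP => [->|_]; [rewrite (negbTE nij)|case: (x == j)].
rewrite -(@subst_subseq2E (mark i j) w i j 0 1) ?mi ?mj //.
- have := mark_lt2 i j w; move: (count_mark0 i j w) (count_mark1 w nij).
  (* Only six words consist of two zeros and two ones. *)
  rewrite ci cj; case: (subst _ _) => [|[|[|x1]] s] //;
  case: s => [|[|[|x2]] s] //; case: s => [|[|[|x3]] s] //;
  case: s => [|[|[|x4]] s] //=; case: s => [|[|[|x5]] s] //=; lia.
- by move=> z _; rewrite mj => /eqP.
- by move=> z _; rewrite mi => /eqP.
Qed.

Lemma realizes_aabb k l r u v :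
  satisfies (Mw aabb) u v -> realizes k l r u = realizes k l r v.
Proof.
have impl u' v' : satisfies (Mw aabb) u' v' -> realizes k l r u' -> realizes k l r v'.
  move=> s /realizesP[h1 h2 h3].
  (* The image under [mark i i] is a power with exponent at most two, hence a factor of [aabb].
     Exponent zero excludes new letters in [v']. *)
  have cnt i : count_mem i u' <= 2 -> count_mem i v' = count_mem i u'.
    have := @Mw_isoterm aabb _ _ (mark i i) s; rewrite !subst_mark1 => e c.
    have /e/(congr1 size) : infix (nseq (count_mem i u') 0) aabb.
      by case: count c => [|[|[|]]].
    by rewrite !size_nseq.
  have h2' i : i < k -> count_mem i v' = 2 by move=> ik; rewrite cnt h2.
  apply/realizesP; split=> //.
    move=> i iv; apply: h1; apply/negPn/negP => /count_memPn ci.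
    by move: iv; rewrite -has_pred1 has_count cnt ci.
  move=> i j ik jk nij; rewrite -h3 //.
  have nji : j != i by rewrite eq_sym.
  apply: negb_inj; rewrite -!mark_aabb ?h2 ?h2' //.
  apply/eqP/eqP => e.
    rewrite -e; apply: (Mw_isoterm (x := aabb)); last by rewrite e infix_refl.
    by move=> f; rewrite s.
  by rewrite -e; apply: (Mw_isoterm s); rewrite e infix_refl.
move=> s; apply/idP/idP; apply: impl => // f; by rewrite s.
Qed.

(** * Substitutions into words realizing prime systems *)

(* Primality of the interval order: a homogeneous set (one whose members are
   not distinguished by any outside element) with two members is everything. *)
Definition prime_system (k : nat) (l r : nat -> nat) : Prop :=
  forall A : pred nat,
    (forall a b c, a < k -> b < k -> c < k -> A a -> A b -> ~~ A c ->
       (l a <= r c) = (l b <= r c) /\ (l c <= r a) = (l c <= r b)) ->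
    forall a b, a < k -> b < k -> A a -> A b -> a != b -> forall c, c < k -> A c.

(** In this right-hand side of the identities any two letters interlace. *)
Definition doubled (k : nat) : seq nat := iota 0 k ++ iota 0 k.

Lemma realizes_perm k l r w : realizes k l r w -> perm_eq w (doubled k).
Proof.
case/realizesP=> h1 h2 _; apply/allP => i _; apply/eqP; rewrite /= /doubled count_cat.
rewrite (count_uniq_mem _ (iota_uniq 0 k)) mem_iota /=.
case: ltnP => [ik|ki]; first by rewrite h2.
by apply/count_memPn/negP => /h1; rewrite ltnNge ki.
Qed.

Section Dichotomy.
Variables (k : nat) (l r : nat -> nat) (k' : nat) (f : nat -> seq nat).
Variables (u p q : seq nat).
Hypothesis primeP : prime_system k l r.
Hypothesis u_perm : perm_eq u (doubled k').
Hypothesis real_u : realizes k l r (p ++ subst f u ++ q).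

(* The letters of [subst f u] occur twice in it, so that they form a
   homogeneous set. *)
Lemma realizes_factor :
  (exists a, all (pred1 a) (subst f u)) \/ p = [::] /\ q = [::].
Proof.
have [h1 h2 h3] := realizesP _ _ _ _ real_u.
have lt_k a : a \in subst f u -> a < k.
  by move=> au; apply: h1; rewrite !mem_cat au orbT.
(* The letter occurs equally often in both halves of the permuted word, so both its occurrences are
   used up inside [subst f u]. *)
have out a : a \in subst f u -> (a \notin p) && (a \notin q).
  move=> au; have := h2 a (lt_k a au); rewrite !count_cat.
  have := au; rewrite -has_pred1 has_count.
  have /permP-> : perm_eq (subst f u) (subst f (doubled k')) by apply: subst_perm.
  rewrite subst_cat count_cat => c1 c2.
  by rewrite -!has_pred1 !has_count; lia.
(* The position of an outside letter [c] relative to [a] depends on [p] and [q] alone, not on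
   [a]. *)
have sub_l a c : a \in subst f u -> c \notin subst f u ->
    subseq [:: c; a] (p ++ subst f u ++ q) = (c \in p).
  move=> au cu; have /andP[ap aq] := out a au.
  rewrite !subseq2_cat mem_cat au (negbTE cu) (negbTE aq) /= andbT.
  by rewrite !subseq2_notin ?ap ?aq ?cu ?orbT // !orbF.
have sub_r a c : a \in subst f u -> c \notin subst f u ->
    subseq [:: a; c] (p ++ subst f u ++ q) = (c \in q).
  move=> au cu; have /andP[ap aq] := out a au.
  rewrite !subseq2_cat mem_cat au (negbTE cu) (negbTE ap) /=.
  by rewrite !subseq2_notin ?ap ?aq ?cu ?orbT // !orbF.
case E : (subst f u) => [|a s]; first by left; exists 0.
case: (boolP (all (pred1 a) (a :: s))) => [al|/allPn[b bs /= nba]]; first by left; exists a.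
right; rewrite -E in bs.
have aS : a \in subst f u by rewrite E inE eqxx.
(* The letters of [subst f u] form a homogeneous set with two members, so primality leaves no letter
   for [p] and [q]. *)
have full c : c < k -> c \in subst f u.
  apply: (primeP (A := mem (subst f u)) _ (lt_k b bs) (lt_k a aS) bs aS nba).
  move=> {c} x y c xk yk ck /= xu yu cu.
  have nxc : x != c by apply: contraNneq cu => <-.
  have nyc : y != c by apply: contraNneq cu => <-.
  have ncx : c != x by rewrite eq_sym.
  have ncy : c != y by rewrite eq_sym.
  by split; rewrite -!h3 //; [rewrite !sub_r|rewrite !sub_l].
have nil s' : {subset s' <= p ++ subst f u ++ q} ->
    (forall a, a \in subst f u -> a \notin s') -> s' = [::].
  case: s' => // x s' sub no.
  have xu : x \in subst f u by apply/full/h1/sub; rewrite inE eqxx.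
  by have := no x xu; rewrite inE eqxx.
by split; apply: nil => x; [rewrite mem_cat => ->| move=> /out/andP[]
  | rewrite !mem_cat => ->; rewrite !orbT | move=> /out/andP[]].
Qed.

End Dichotomy.

Section Embedding.
Variables (k : nat) (l r : nat -> nat) (k' : nat) (l' r' : nat -> nat).
Variables (f : nat -> seq nat) (u : seq nat).
Hypothesis real_u : realizes k' l' r' u.
Hypothesis real_fu : realizes k l r (subst f u).

(** The letter of [u] whose image contains [a]; the default of [find] is [k']. *)
Let g a := find (fun y => a \in f y) (iota 0 k').

Lemma realizes_letter a : a < k -> g a < k' /\ a \in f (g a).
Proof.
have [h1 h2 h3] := realizesP _ _ _ _ real_fu.
have [h1' _ _] := realizesP _ _ _ _ real_u.
move=> ak.
have /mem_substP[y yu ay] : a \in subst f u by rewrite -has_pred1 has_count h2.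
have hy : has (fun y => a \in f y) (iota 0 k').
  by apply/hasP; exists y => //; rewrite mem_iota h1'.
have := hy; rewrite has_find size_iota => gk; split=> //.
by have := nth_find 0 hy; rewrite nth_iota.
Qed.

(** A letter shared by the images of two letters, each occurring twice in [u], would occur at least
    four times. *)
Lemma realizes_letter_uniq a : a < k -> {in u, forall y, a \in f y -> y = g a}.
Proof.
have [_ h2 _] := realizesP _ _ _ _ real_fu.
have [h1' _ _] := realizesP _ _ _ _ real_u.
move=> ak y yu ay; have [gk ag] := realizes_letter ak.
apply/eqP; case: eqVneq => // ny.
have := h2 a ak.
have /permP-> : perm_eq (subst f u) (subst f (doubled k')).
  exact/subst_perm/(realizes_perm real_u).
set xs := iota 0 k'.
have gxs : g a \in xs by rewrite mem_iota.
have yxs : y \in rem (g a) xs by rewrite mem_rem_uniq ?iota_uniq // !inE ny mem_iota h1'.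
have /permP pc : perm_eq (subst f xs) (subst f (g a :: y :: rem y (rem (g a) xs))).
  apply: subst_perm; rewrite (permPl (perm_to_rem gxs)) perm_cons.
  exact: perm_to_rem.
rewrite /doubled -/xs subst_cat count_cat pc !subst_cons !count_cat.
by move: ay ag; rewrite -!has_pred1 !has_count; lia.
Qed.

(** Letters in one image meet because that image occurs twice; letters in different images inherit
    the order of the images. *)
Lemma realizes_subst_le a b : a < k -> b < k -> a != b ->
  (l a <= r b) = (g a == g b) || (l' (g a) <= r' (g b)).
Proof.
have [_ _ h3] := realizesP _ _ _ _ real_fu.
have [_ h2' h3'] := realizesP _ _ _ _ real_u.
move=> ak bk nab; have [gak ag] := realizes_letter ak; have [gbk bg] := realizes_letter bk.
case: eqVneq => [eg|ng] /=.
  rewrite -h3 //; apply: (subst_subseq2 (x := g a) _ ag); last by rewrite eg.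
  exact/subseq_count2/h2'.
rewrite -h3 // -h3' //; apply: subst_subseq2E => //; first by rewrite eq_sym.
  exact: realizes_letter_uniq.
exact: realizes_letter_uniq.
Qed.

(* The fibres of [g] are homogeneous. *)
Lemma realizes_embedding : prime_system k l r ->
  (exists a b, [/\ a < k, b < k, a != b & r b < l a]) ->
  exists h : nat -> nat, [/\ forall a, a < k -> h a < k',
     forall a b, a < k -> b < k -> h a = h b -> a = b &
     forall a b, a < k -> b < k -> a != b -> (l a <= r b) = (l' (h a) <= r' (h b))].
Proof.
move=> primeP [a0 [b0 [a0k b0k ab0 lt0]]].
have inj a b : a < k -> b < k -> g a = g b -> a = b.
  move=> ak bk eg; apply/eqP; case: eqVneq => // nab.
  (* By primality a fibre with two members is everything, and then all intervals meet, against
     [lt0]. *)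
  have all_eq c : c < k -> g c == g a.
    apply: (primeP (fun c => g c == g a) _ a b ak bk (eqxx _) (introT eqP (esym eg)) nab).
    move=> {c} x y c xk yk ck /= /eqP gx /eqP gy ngc.
    have nxc : x != c by apply: contraNneq ngc => <-; rewrite gx.
    have nyc : y != c by apply: contraNneq ngc => <-; rewrite gy.
    have ncx : c != x by rewrite eq_sym.
    have ncy : c != y by rewrite eq_sym.
    by rewrite !realizes_subst_le // gx gy (eq_sym (g a)) (negbTE ngc).
  move: lt0; rewrite ltnNge realizes_subst_le //.
  by rewrite (eqP (all_eq _ a0k)) (eqP (all_eq _ b0k)) eqxx.
exists g; split=> // [a ak|a b ak bk nab]; first by case: (realizes_letter ak).
rewrite realizes_subst_le //; case: eqP => // /inj e; case/eqP: nab; exact: e.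
Qed.

End Embedding.

(** Every letter would lie in both halves, so no two intervals could be disjoint. *)
Lemma doubled_not_realizes k l r k' f :
  (exists a b, [/\ a < k, b < k, a != b & r b < l a]) ->
  ~~ realizes k l r (subst f (doubled k')).
Proof.
move=> [a [b [ak bk nab lt]]]; apply/negP => /realizesP[_ h2 h3].
move: lt; rewrite ltnNge -h3 // /doubled subst_cat subseq2_cat.
have mem c : c < k -> c \in subst f (iota 0 k').
  move=> ck; have := h2 c ck; rewrite /doubled subst_cat count_cat.
  by rewrite -has_pred1 has_count; lia.
by rewrite !mem //= orbT.
Qed.

(** If one image is a power of a letter, the two images coincide, being permutations of each other.
    Otherwise the context is empty: a realizing image of [u] yields a forbidden embedding, and
    [doubled] has no realizing image. *)
Lemma realizes_satisfies k l r k' l' r' u :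
  prime_system k l r -> (exists a b, [/\ a < k, b < k, a != b & r b < l a]) ->
  realizes k' l' r' u ->
  ~ (exists h : nat -> nat, [/\ forall a, a < k -> h a < k',
     forall a b, a < k -> b < k -> h a = h b -> a = b &
     forall a b, a < k -> b < k -> a != b -> (l a <= r b) = (l' (h a) <= r' (h b))]) ->
  satisfies (synMon (realizes k l r)) u (doubled k').
Proof.
move=> primeP incP real_u noemb; apply: synMon_satisfies => f p q.
have pu := realizes_perm real_u.
have pfu := subst_perm f pu.
have const s t : perm_eq s t -> (exists a : nat, all (pred1 a) s) -> s = t.
  move=> st [a sa]; have ta : all (pred1 a) t by rewrite -(perm_all _ st).
  by rewrite (all_pred1P _ _ sa) (all_pred1P _ _ ta) (perm_size st).
apply/idP/idP => real.
  case: (realizes_factor primeP pu real) => [/(const _ _ pfu) <- //|[p0 q0]].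
  have real' : realizes k l r (subst f u) by move: real; rewrite p0 q0 cats0.
  by case: noemb; apply: (realizes_embedding real_u real').
case: (realizes_factor primeP (perm_refl _) real) => [|[p0 q0]].
  by move=> ca; rewrite -(const _ (subst f u) _ ca) // perm_sym.
by have := doubled_not_realizes k' f incP; move: real; rewrite p0 q0 cats0 => ->.
Qed.

(** * The word of an interval system *)

Section IntervalWord.
Variables (k : nat) (l r : nat -> nat).
Hypothesis le_lr : forall i, l i <= r i.

Definition points_at (h : nat -> nat) (t : nat) : seq nat := [seq i <- iota 0 k | h i == t].

(** At each coordinate left endpoints come before right ones, so that intervals touching at a point
    count as meeting. *)
Definition sweep (s n : nat) : seq nat :=
  flatten [seq points_at l t ++ points_at r t | t <- iota s n].

Lemma mem_points_at h t i : (i \in points_at h t) = (i < k) && (h i == t).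
Proof. by rewrite mem_filter mem_iota andbC. Qed.

Lemma mem_sweep s n i :
  (i \in sweep s n) = (i < k) && ((s <= l i < s + n) || (s <= r i < s + n)).
Proof.
apply/flatten_mapP/andP => [[t]|[ik h]].
  by rewrite mem_iota mem_cat !mem_points_at => ht /orP[]/andP[-> /eqP->]; rewrite ht ?orbT.
case/orP: h => h; [exists (l i)|exists (r i)];
by rewrite ?mem_iota // mem_cat !mem_points_at ik eqxx ?orbT.
Qed.

Lemma sweep_cat s n m : sweep s (n + m) = sweep s n ++ sweep (s + n) m.
Proof. by rewrite /sweep iotaD map_cat flatten_cat. Qed.

Lemma count_sweep s n i : i < k ->
  count_mem i (sweep s n) = (s <= l i < s + n) + (s <= r i < s + n).
Proof.
have cp h t : i < k -> count_mem i (points_at h t) = (h i == t).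
  by move=> ik; rewrite count_uniq_mem ?filter_uniq ?iota_uniq // mem_points_at ik.
move=> ik; elim: n s => [|n IH] s; first by rewrite /sweep /=; lia.
rewrite -[n.+1]add1n sweep_cat count_cat IH.
rewrite /sweep /= cats0 count_cat !cp //; lia.
Qed.

Lemma sweep_realizes n : (forall i, i < k -> r i < n) -> realizes k l r (sweep 0 n).
Proof.
move=> rn; apply/realizesP; split=> [i|i ik|i j ik jk nij].
- by rewrite mem_sweep => /andP[].
- by rewrite count_sweep // !add0n rn // (leq_ltn_trans (le_lr i) (rn i ik)).
have [ri rj li lj] : [/\ r i < n, r j < n, l i <= r i & l j <= r j] by rewrite !rn.
(* The sweep is cut at [l i]: [j] still has its right endpoint to come if [l i <= r j], and is
   finished otherwise. *)
have -> : n = l i + (1 + (n - l i).-1) by lia.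
rewrite sweep_cat; case: leqP => h.
  rewrite sweep_cat add0n.
  rewrite {2}/sweep /= cats0 -!catA catA subseq2_cat; apply/or3P; constructor 2.
  rewrite !mem_cat !mem_points_at !mem_sweep ik jk eqxx orbT /=; lia.
by rewrite subseq2_cat !subseq2_notin ?mem_sweep ?ik ?jk //=; lia.
Qed.

End IntervalWord.

(** * An antichain of prime interval systems *)

(* The intervals [2i, 2i+2] for [i <= n + 6] form a chain of consecutively
   overlapping intervals; letters [n + 7] and [n + 8] are the midpoints of its third
   interval and of its third interval from the end. *)
Definition lend (n i : nat) : nat :=
  if i <= n + 6 then 2 * i else if i == n + 7 then 5 else 2 * n + 9.
Definition rend (n i : nat) : nat :=
  if i <= n + 6 then 2 * i + 2 else if i == n + 7 then 5 else 2 * n + 9.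

Local Ltac ends := rewrite /lend /rend; repeat case: ifP => ?; lia.

(** A letter that distinguishes two members of [A] must join [A]. Two consecutive chain intervals
    thus generate the chain and then the midpoints, and any other pair generates two consecutive
    ones. *)
Lemma lend_prime n : prime_system (n + 9) (lend n) (rend n).
Proof.
move=> A hA.
have cl a b c : a < n + 9 -> b < n + 9 -> c < n + 9 -> A a -> A b ->
    (rend n a < lend n c <= rend n b) || (lend n a <= rend n c < lend n b) -> A c.
  move=> ak bk ck Aa Ab h; apply: contraT => nAc.
  by have := hA a b c ak bk ck Aa Ab nAc; move: h; lia.
have up i j : A i -> A i.+1 -> i + j <= n + 5 -> A (i + j) && A (i + j).+1.
  move=> Ai Ai1; elim: j => [|j IH] ij; first by rewrite addn0 Ai Ai1.
  have /andP[A1 A2] := IH ltac:(lia).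
  rewrite addnS A2 /=; apply: (cl (i + j) (i + j).+1) => //; ends.
have down i j : A (i + j) -> A (i + j).+1 -> i + j <= n + 5 -> A i && A i.+1.
  elim: j => [|j IH]; first by rewrite addn0 => -> ->.
  rewrite addnS => A1 A2 ij; apply: IH => //; last lia.
  apply: (cl (i + j).+1 (i + j).+2) => //; ends.
have fromadj i : A i -> A i.+1 -> i <= n + 5 -> forall c, c < n + 9 -> A c.
  move=> Ai Ai1 ii.
  have Ax j : j <= n + 5 -> A j && A j.+1.
    move=> jn; case: (leqP i j) => ij.
      by rewrite -(subnKC ij); apply: up => //; lia.
    by apply: (down j (i - j)); rewrite subnKC //; lia.
  have Ay c : c <= n + 6 -> A c.
    case: c => [|c] cn; first by case/andP: (Ax 0 (leq0n _)).
    by case/andP: (Ax c ltac:(lia)).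
  move=> c ck; case: (leqP c (n + 6)) => cn; first exact: Ay.
  case: (eqVneq c (n + 7)) => cn7.
    (* The midpoint 5 lies in interval 2 and to the left of interval 3. *)
    apply: (cl 2 3) => //; rewrite ?Ay; ends.
  apply: (cl (n + 4) (n + 5)) => //; rewrite ?Ay; ends.
have fromxx i j : i < j -> j <= n + 6 -> A i -> A j -> forall c, c < n + 9 -> A c.
  move=> ij jn Ai Aj; case: (ltnP j (n + 6)) => jn'.
    apply: (fromadj j) => //; last lia.
    by apply: (cl i j) => //; ends.
  have ej : j = n + 6 by lia.
  case: (posnP i) => i0.
    apply: (fromadj (n + 5)) => //; last by rewrite -addnS -ej.
    by apply: (cl i j) => //; ends.
  have e : i = i.-1.+1 by lia.
  apply: (fromadj i.-1); rewrite -?e //; last lia.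
  by apply: (cl i j) => //; ends.
have fromxy i j : i <= n + 6 -> n + 6 < j < n + 9 -> A i -> A j ->
    forall c, c < n + 9 -> A c.
  move=> ii jj Ai Aj.
  suff [c [cn nci Ac]] : exists c, [/\ c <= n + 6, c != i & A c].
    by case: (ltngtP c i) nci => // h _; [apply: (fromxx c i)|apply: (fromxx i c)].
  (* The chain interval around the midpoint [j]; on either side of it a neighbour of [i]
     distinguishes [i] from [j]. *)
  pose m := if j == n + 7 then 2 else n + 4.
  case: (ltnP i m) => im.
    case: (posnP i) => i0; [exists 1|exists i.-1]; split; try lia;
    by apply: (cl i j) => //; move: im; rewrite /m; ends.
  case: (eqVneq i (n + 6)) => i6; [exists (n + 5)|exists i.+1]; split; try lia;
  by apply: (cl j i) => //; move: im; rewrite /m; ends.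
move=> a b; wlog ab : a b / a < b => [W|].
  move=> ak bk Aa Ab nab; have /orP[h|h] : (a < b) || (b < a) by lia.
    exact: (W a b).
  by apply: (W b a) => //; lia.
move=> ak bk Aa Ab _.
case: (leqP b (n + 6)) => bn; first exact: (fromxx a b).
case: (leqP a (n + 6)) => an; first by apply: (fromxy a b) => //; lia.
apply: (fromxy (n + 4) a) => //; try lia.
by apply: (cl a b) => //; ends.
Qed.

(** Here [b] lies strictly inside [v]. Chain intervals have length two, so [b] is a midpoint and [v]
    the chain interval around it. *)
Lemma lend_claw n v a b c : v < n + 9 -> a < n + 9 -> b < n + 9 -> c < n + 9 ->
  rend n a < lend n b -> rend n b < lend n c -> lend n v <= rend n a -> lend n c <= rend n v ->
  v = 2 \/ v = n + 4.
Proof. ends. Qed.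

Lemma antichain m n (h : nat -> nat) :
  (forall a, a < m + 9 -> h a < n + 9) ->
  (forall a b, a < m + 9 -> b < m + 9 -> h a = h b -> a = b) ->
  (forall a b, a < m + 9 -> b < m + 9 -> a != b ->
     (lend m a <= rend m b) = (lend n (h a) <= rend n (h b))) ->
  m = n.
Proof.
move=> hk hinj hle.
have le_mn : m <= n.
  have /uniq_leq_size : uniq (map h (iota 0 (m + 9))).
    rewrite map_inj_in_uniq ?iota_uniq // => a b; rewrite !mem_iota; exact: hinj.
  move/(_ (iota 0 (n + 9))); rewrite size_map !size_iota leq_add2r; apply.
  by move=> _ /mapP[a + ->]; rewrite !mem_iota; apply: hk.
(* Midpoints are recognised as the middle leaves of claws, so [h] maps the two claw
   centres to the two claw centres, and the chain between them cannot be shorter. *)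
have claw v a b c : v < m + 9 -> a < m + 9 -> b < m + 9 -> c < m + 9 ->
    uniq [:: v; a; b; c] -> rend m a < lend m b -> rend m b < lend m c ->
    lend m v <= rend m a -> lend m c <= rend m v -> h v = 2 \/ h v = n + 4.
  rewrite /= !inE !negb_or => vk ak bk ck /and4P[/and3P[va vb vc] /andP[ab ac] bc _].
  move=> rab rbc lva lcv.
  apply: (@lend_claw n (h v) (h a) (h b) (h c)); rewrite ?hk //.
  - by rewrite ltnNge -hle 1?eq_sym // -ltnNge.
  - by rewrite ltnNge -hle 1?eq_sym // -ltnNge.
  - by rewrite -hle.
  - by rewrite -hle 1?eq_sym.
have h2 : h 2 = 2 \/ h 2 = n + 4.
  by apply: (@claw 2 1 (m + 7) 3); rewrite /= ?inE; ends.
have h4 : h (m + 4) = 2 \/ h (m + 4) = n + 4.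
  by apply: (@claw (m + 4) (m + 3) (m + 8) (m + 5)); rewrite /= ?inE; ends.
(* Disjointness with its direction excludes the other assignments of the centres. *)
have h24 : rend n (h 2) < lend n (h (m + 4)).
  rewrite ltnNge -hle; ends.
have {h2 h24 h4} [h2 h4] : h 2 = 2 /\ h (m + 4) = n + 4.
  by case: h2 h4 h24 => -> [] -> //; ends.
(* Each step to a meeting interval moves the right end by at most two; at [i = m + 2] this gives
   [n <= m]. *)
have path i : i <= m + 2 -> rend n (h (2 + i)) <= 2 * i + 6.
  elim: i => [|i IH] im; first by rewrite addn0 h2 /rend; case: ifP; lia.
  have := IH ltac:(lia).
  have : lend n (h (2 + i.+1)) <= rend n (h (2 + i)).
    rewrite -hle; ends.
  ends.
have := path (m + 2) (leqnn _); rewrite (_ : 2 + (m + 2) = m + 4) ?h4; last by lia.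
ends.
Qed.

(** * Independence of the identities *)

Theorem theorem1 : uncountably_many_subvarieties (Mw aabb).
Proof.
pose L n := realizes (n + 9) (lend n) (rend n).
(* The bound exceeds the largest right endpoint, [2 * n + 14]. *)
pose u n := sweep (n + 9) (lend n) (rend n) 0 (2 * n + 20).
have real_u n : L n (u n).
  apply: sweep_realizes => i; first ends.
  ends.
have incP n : exists a b, [/\ a < n + 9, b < n + 9, a != b & rend n b < lend n a].
  exists 2, 0; split; try lia.
  by rewrite /lend /rend leq0n (_ : 2 <= n + 6) //; lia.
apply: (@uncountable_of_independent _ (fun n => synMon (L n)) u (fun n => doubled (n + 9))).
- by move=> n; apply: synMon_varGen => v w; apply: realizes_aabb.
- move=> m n neq; apply: realizes_satisfies (real_u n) _ => //; first exact: lend_prime.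
  by case=> h [hk hinj hle]; apply: neq; apply: antichain hk hinj hle.
- move=> n /synMon_satisfiesW; rewrite real_u => e.
  (* The identity substitution shows that [doubled (n + 9)] itself is not in [L n]. *)
  have := doubled_not_realizes (n + 9) (fun x => [:: x]) (incP n).
  by rewrite /subst flatten_seq1 -/(L n) -e.
Qed.
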